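(* Let $\Sigma=\{A_j : j\in J\}$, $J=\{1,\dots,k\}$, be a finite set of real $n\times n$-matrices. Consider the three properties: (LCP) $\Sigma$ is LCP; (RCP) $\Sigma$ is RCP; (TR) $\Sigma$ is transversal. Then any two of the properties LCP, RCP, and TR imply the third one.
   Context: $\Sigma$ is LCP (left convergent products) if for every infinite sequence $j_1,j_2,\dots$ in $J$ the left products $A_{j_m}\cdots A_{j_1}$ converge to a limit matrix as $m\to\infty$. $\Sigma$ is RCP (right convergent products) if for every infinite sequence $j_1,j_2,\dots$ in $J$ the right products $A_{j_1}\cdots A_{j_m}$ converge to a limit matrix as $m\to\infty$. For $J'\subseteq J$ put $N_{J'}=\bigcap_{j\in J'}N(I-A_j)$ and $R_{J'}=\mathrm{span}_{j\in J'}\{R(I-A_j)\}$ (the sum of the ranges), where $N(A)=\{x\in\mathbb{R}^n: Ax=0\}$ is the nullspace of $A$, $R(A)=\{Ax: x\in\mathbb{R}^n\}$ is its range, and $I$ is the identity matrix. $\Sigma$ is transversal (TR) if $N_{J'}\oplus R_{J'}=\mathbb{R}^n$ for each $J'\subseteq J$, that is, $N_{J'}\cap R_{J'}=\{0\}$ and $N_{J'}+R_{J'}=\mathbb{R}^n$ for each $J'\subseteq J$. *)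

(* Defs.v *)
From mathcomp Require Import all_boot all_order all_algebra.
From mathcomp Require Import all_classical all_reals all_analysis.
Import Order.TTheory GRing.Theory Num.Theory.
Import numFieldNormedType.Exports.

Set Implicit Arguments.
Unset Strict Implicit.
Unset Printing Implicit Defensive.

Local Open Scope classical_set_scope.
Local Open Scope ring_scope.

Section MatrixProducts.
Context {R : realType} {n k : nat}.
Implicit Types (A : 'I_k -> 'M[R]_n) (s : nat -> 'I_k).

(* Indices are 0-based: s 0, s 1, ... stand for j_1, j_2, ...
   The value at m is A_{j_m} ... A_{j_1}, resp. A_{j_1} ... A_{j_m}. *)
Fixpoint left_product A s (m : nat) : 'M[R]_n :=
  if m is m'.+1 then A (s m') *m left_product A s m' else 1%:M.

Fixpoint right_product A s (m : nat) : 'M[R]_n :=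
  if m is m'.+1 then right_product A s m' *m A (s m') else 1%:M.

Definition LCP A : Prop :=
  forall s, exists L : 'M[R]_n, left_product A s @ \oo --> L.

Definition RCP A : Prop :=
  forall s, exists L : 'M[R]_n, right_product A s @ \oo --> L.

(* Matrices act on column vectors; the row-space operations of mxalgebra
   (kermx, addsmx, capmx) would instead use the action on rows. *)
Definition mxact (M : 'M[R]_n) : 'End('cV[R]_n) :=
  linfun (fun x : 'cV[R]_n => M *m x).

Definition nullspace (M : 'M[R]_n) : {vspace 'cV[R]_n} := lker (mxact M).

Definition range_space (M : 'M[R]_n) : {vspace 'cV[R]_n} := limg (mxact M).

Definition common_null A (J' : {set 'I_k}) : {vspace 'cV[R]_n} :=
  (\bigcap_(j in J') nullspace (1%:M - A j))%VS.

Definition range_span A (J' : {set 'I_k}) : {vspace 'cV[R]_n} :=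
  (\sum_(j in J') range_space (1%:M - A j))%VS.

Definition transversal_family A : Prop :=
  forall J' : {set 'I_k},
    (common_null A J' :&: range_span A J' = 0)%VS /\
    (common_null A J' + range_span A J' = fullv)%VS.

Lemma memv_nullspace (M : 'M[R]_n) (x : 'cV[R]_n) :
  x \in nullspace M <-> M *m x = 0.
Proof. by rewrite memv_ker lfunE; split => [/eqP|/eqP]. Qed.

Lemma memv_range_space (M : 'M[R]_n) (y : 'cV[R]_n) :
  y \in range_space M <-> exists x : 'cV[R]_n, y = M *m x.
Proof.
split=> [/memv_imgP[x _ ->]|[x ->]]; first by exists x; rewrite lfunE.
by apply/memv_imgP; exists x; rewrite ?memvf // lfunE.
Qed.

End MatrixProducts.

(* Main.v *)
Require Import Defs.
From mathcomp Require Import all_boot all_order all_algebra.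
From mathcomp Require Import all_classical all_reals all_analysis.
Import Order.TTheory GRing.Theory Num.Theory.
Import numFieldNormedType.Exports.
From mathcomp Require Import ring.

Set Implicit Arguments.
Unset Strict Implicit.
Unset Printing Implicit Defensive.

Local Open Scope classical_set_scope.
Local Open Scope ring_scope.

(** Write N and R for the common nullspace and the sum of ranges attached to a
set J of letters, and say that a sequence of letters exhausts J when it stays
in J and visits every letter of J infinitely often.

Suppose the left products along a sequence exhausting J converge to L. Passing
to the limit in X_(m+1) = A_j X_m at the visits of j gives A_j L = L, so L maps
into N; and L x - x lies in R because every partial product changes x by an
element of R. Hence x = L x + (x - L x) shows that N and R span the whole space
([LCP_add]). Dually, a limit M of right products satisfies M A_j = M, hence
kills R, while it is the identity on N, where every A_j is; so N and R meet in
0 ([RCP_cap]). Together these say that LCP and RCP imply transversality.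

Conversely, LCP and the mere triviality of all the intersections of N and R
imply RCP ([LCP_RCP]). Discarding a finite prefix, a sequence s exhausts the
set J of the letters that it visits infinitely often; let L be the limit of its
left products. As N and R meet in 0, every other sequence exhausting J has the
same left limit. LCP makes all products uniformly bounded ([LCP_bounded]), so
for a row vector z the orbit y_m = z A_(s_0) ... A_(s_(m-1)) is bounded, and it
is enough to show that z L is its only cluster point. Let y be one. Between two
visits of the orbit to a neighbourhood of y, as far apart as desired, it reads
a block of letters of s whose product nearly fixes y on the right. Choose such
blocks that contain all of J and have errors e_1, e_2, ... of small sum. Read
backwards and put one after the other they form an infinite word exhausting J,
whose left products converge to L and, by telescoping, move y only by a
multiple of the sum of the e_i. So y L = y ([recurrent_row_fixed]). On the
other hand A_j L = L gives y_m L = z L for all m, hence y L = z L, and y = z L.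

The last implication follows by transposition: RCP becomes LCP of the
transposed family, and spanning by N and R for the family forces the
intersection of N and R to be 0 for the transposed family ([cap_tr]), which is
all that [LCP_RCP] asks for. *)

(** * Norms and limits of matrices *)

Lemma mx_norm_entry (R : realType) (p q : nat) (M : 'M[R]_(p, q)) i j :
  `|M i j| <= `|M|.
Proof.
rewrite [leRHS]/Num.Def.normr /= mx_normrE.
by apply/bigmax_geP; right => /=; exists (i, j).
Qed.

Lemma mx_norm_le (R : realType) (p q : nat) (M : 'M[R]_(p, q)) C :
  0 <= C -> (forall i j, `|M i j| <= C) -> `|M| <= C.
Proof.
move=> C0 MC; rewrite [leLHS]/Num.Def.normr /= mx_normrE.
by apply/bigmax_leP; split => //= -[i j] _; exact: MC.
Qed.

Lemma mx_norm_mulmx (R : realType) (p q r : nat)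
    (M : 'M[R]_(p, q)) (N : 'M[R]_(q, r)) :
  `|M *m N| <= q%:R * (`|M| * `|N|).
Proof.
apply: mx_norm_le => [|i j]; first by rewrite !mulr_ge0.
rewrite mxE (le_trans (ler_norm_sum _ _ _)) //.
rewrite (@le_trans _ _ (\sum_(l < q) `|M| * `|N|)) //.
  apply: ler_sum => l _; rewrite normrM.
  by rewrite ler_pM // mx_norm_entry.
by rewrite sumr_const card_ord mulr_natl.
Qed.

Lemma mx_cvgP (R : realType) (p q : nat) (X : nat -> 'M[R]_(p, q))
    (L : 'M[R]_(p, q)) :
  X @ \oo --> L <-> forall i j, X m i j @[m --> \oo] --> L i j.
Proof.
split=> [XL i j|XL]; first exact: (cvg_comp _ _ XL (@coord_continuous _ _ _ i j L)).
apply/cvgrPdistC_le => e e0.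
have : \forall m \near \oo, forall i, `[< forall j, `|X m i j - L i j| <= e >].
  apply: filter_forall => i.
  have : \forall m \near \oo, forall j, `|X m i j - L i j| <= e.
    by apply: filter_forall => j; move/cvgrPdistC_le: (XL i j); exact.
  by apply: filterS => m Hm; apply/asboolP.
apply: filterS => m Hm; apply: mx_norm_le => [|i j]; first exact: ltW.
by have /asboolP/(_ j) := Hm i; rewrite !mxE.
Qed.

Lemma cvg_mulmxl (R : realType) (p q r : nat) (X : nat -> 'M[R]_(q, r))
    (L : 'M[R]_(q, r)) (G : 'M[R]_(p, q)) :
  X @ \oo --> L -> (fun m => G *m X m) @ \oo --> G *m L.
Proof.
move=> /mx_cvgP XL; apply/mx_cvgP => i j.
rewrite mxE; under eq_cvg do rewrite mxE.
apply: (cvg_big (op := +%R)) => [|l _]; first exact: add_continuous.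
exact: cvgMl_tmp.
Qed.

Lemma cvg_mulmxr (R : realType) (p q r : nat) (X : nat -> 'M[R]_(p, q))
    (L : 'M[R]_(p, q)) (H : 'M[R]_(q, r)) :
  X @ \oo --> L -> (fun m => X m *m H) @ \oo --> L *m H.
Proof.
move=> /mx_cvgP XL; apply/mx_cvgP => i j.
rewrite mxE; under eq_cvg do rewrite mxE.
apply: (cvg_big (op := +%R)) => [|l _]; first exact: add_continuous.
exact: cvgMr_tmp.
Qed.

Lemma cvg_trmx (R : realType) (p q : nat) (X : nat -> 'M[R]_(p, q))
    (L : 'M[R]_(p, q)) :
  X @ \oo --> L -> (fun m => (X m)^T) @ \oo --> L^T.
Proof.
move=> /mx_cvgP XL; apply/mx_cvgP => i j.
rewrite mxE; under eq_cvg do rewrite mxE.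
exact: XL.
Qed.

Lemma cvg_frequently0 (R : realType) (V : normedModType R) (X : nat -> V) (L : V) :
  X @ \oo --> L -> (forall m, exists2 p, (m <= p)%N & X p = 0) -> L = 0.
Proof.
move=> XL X0; apply/eqP; rewrite -normr_le0; apply/ler_addgt0Pr => e e0.
rewrite add0r; move/cvgrPdist_le: XL => /(_ e e0) [m _ Hm].
by have [p mp Xp] := X0 m; have := Hm p mp; rewrite Xp subr0.
Qed.

Lemma mulmx_cV_inj (R : realType) (p q : nat) (M N : 'M[R]_(p, q)) :
  (forall x : 'cV[R]_q, M *m x = N *m x) -> M = N.
Proof.
move=> MN; apply/matrixP => i j; have := MN (delta_mx j 0).
by rewrite -!colE => /colP/(_ i); rewrite !mxE.
Qed.

(** Writing a subspace as the kernel of a matrix makes it visibly closed: the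
limit of vectors of the subspace is still annihilated by the matrix. *)
Lemma vspace_mulmx_kernel (R : realType) (n : nat) (U : {vspace 'cV[R]_n}) :
  exists G : 'M[R]_n, forall x, x \in U <-> G *m x = 0.
Proof.
pose f := (\1 - projv U)%VF.
have fE (x : 'cV[R]_n) : f x = x - projv U x by rewrite !lfun_simp.
exists (\matrix_(i, j) f (delta_mx j 0) i 0) => x.
suff -> : \matrix_(i, j) f (delta_mx j 0) i 0 *m x = f x.
  rewrite fE; split=> [xU|/eqP]; first by rewrite projv_id // subrr.
  by rewrite subr_eq0 => /eqP ->; exact: memv_proj.
rewrite {2}[x]matrix_sum_delta linear_sum; apply/matrixP => i j.
rewrite mxE summxE ord1; apply: eq_bigr => l _.
by rewrite big_ord1 linearZ !mxE mulrC.
Qed.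

(** * Products along finite and infinite words *)

(** The head of the word is the letter that acts first on column vectors, so
that appending letters to a word extends a left product. *)
Fixpoint word_mx (R : realType) (n k : nat) (A : 'I_k -> 'M[R]_n)
    (w : seq 'I_k) : 'M[R]_n :=
  if w is j :: w' then word_mx A w' *m A j else 1%:M.

Section Words.
Context (R : realType) (n k : nat) (A : 'I_k -> 'M[R]_n).
Implicit Types (s : nat -> 'I_k).

Lemma word_mx_cat u v : word_mx A (u ++ v) = word_mx A v *m word_mx A u.
Proof.
by elim: u => [|j u IH] /=; rewrite ?mulmx1 // IH mulmxA.
Qed.

Lemma word_mx1 j : word_mx A [:: j] = A j.
Proof. by rewrite /= mul1mx. Qed.

Lemma left_product_word s m : left_product A s m = word_mx A (mkseq s m).
Proof.
elim: m => [//|m IH].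
by rewrite mkseqS -cats1 word_mx_cat word_mx1 -IH.
Qed.

(** Right products multiply in the opposite order, hence the reversal. *)
Lemma right_product_word s m p :
  right_product A s (m + p) =
  right_product A s m *m word_mx A (rev (mkseq (fun i => s (m + i)%N) p)).
Proof.
elim: p => [|p IH]; first by rewrite addn0 /= mulmx1.
by rewrite mkseqS rev_rcons /= mulmxA -IH addnS.
Qed.

Lemma right_productE s m :
  right_product A s m = word_mx A (rev (mkseq s m)).
Proof. by rewrite -[m in LHS]add0n right_product_word mul1mx. Qed.

End Words.

(** Strict growth of the sizes makes the common extension of the words
infinite, so that it is a function on all of nat. *)
Lemma infinite_word (T : eqType) (u : nat -> seq T) :
  (forall q, prefix (u q) (u q.+1)) -> (forall q, size (u q) < size (u q.+1))%N ->
  exists t : nat -> T, forall q, mkseq t (size (u q)) = u q.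
Proof.
move=> upre usz.
have qsz q : (q <= size (u q))%N.
  by elim: q => // q IH; exact: leq_ltn_trans (usz q).
have premono p q : (p <= q)%N -> prefix (u p) (u q).
  elim: q => [|q IH]; first by rewrite leqn0 => /eqP ->; exact: prefix_refl.
  rewrite leq_eqVlt => /predU1P[->|/IH]; first exact: prefix_refl.
  by move=> /prefix_trans; apply.
have [d _] : exists d : T, True.
  by have := qsz 1; case: (u 1) => [//|d ? _]; exists d.
(* Position i is settled in u i.+1, whose size exceeds i. *)
exists (fun i => nth d (u i.+1) i) => q.
apply: (@eq_from_nth _ d); rewrite size_mkseq // => i iq.
rewrite nth_mkseq //.
case: (leqP q i.+1) => [/premono|/ltnW/premono] /prefixP[v ->]; rewrite nth_cat.
  by rewrite iq.
by rewrite qsz.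
Qed.

(** * Uniform boundedness of the products of an LCP family *)

(** The subspace is one of largest dimension among those on which P holds:
adding to it the line of a further vector satisfying P would contradict
maximality. *)
Lemma vspace_of_pred (F : fieldType) (vT : vectType F) (P : vT -> Prop) :
  P 0 -> (forall a x y, P x -> P y -> P (a *: x + y)) ->
  exists U : {vspace vT}, forall x, x \in U <-> P x.
Proof.
move=> P0 Plin.
pose dims d := `[< exists U : {vspace vT},
  \dim U = d /\ forall x, x \in U -> P x >].
have exd : exists d, dims d.
  exists 0; apply/asboolP; exists 0%VS; rewrite dimv0; split=> // x.
  by rewrite memv0 => /eqP ->.
have led d : dims d -> (d <= \dim (fullv : {vspace vT}))%N.
  by move=> /asboolP[U [<- _]]; exact: dimvS (subvf U).
case: (ex_maxnP exd led) => _ /asboolP[U [<- UP]] Umax.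
exists U => x; split=> [/UP//|Px].
suff /eqP -> : (U == U + <[x]>)%VS by exact: subvP (addvSr _ _) _ (memv_line x).
rewrite eqEdim addvSl; apply: Umax; apply/asboolP; eexists; split=> // y.
by move=> /memv_addP[z /UP Pz [_ /vlineP[a ->] ->]]; rewrite addrC; exact: Plin.
Qed.

Section Boundedness.
Context (R : realType) (n k : nat) (A : 'I_k -> 'M[R]_n).

Definition bounded_orbit (x : 'cV[R]_n) :=
  exists C, forall w, `|word_mx A w *m x| <= C.

Lemma bounded_orbit_lin a x y :
  bounded_orbit x -> bounded_orbit y -> bounded_orbit (a *: x + y).
Proof.
move=> [C xC] [D yD]; exists (`|a| * C + D) => w.
rewrite mulmxDr -scalemxAr (le_trans (ler_normD _ _)) // lerD // normrZ.
by rewrite ler_wpM2l.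
Qed.

(** The vectors of bounded orbit form a subspace, so bounds for the projections
of the n basis vectors onto it give one bound for all of them. *)
Lemma bounded_orbit_uniform :
  exists C, 0 <= C /\
    forall x w, bounded_orbit x -> `|word_mx A w *m x| <= C * `|x|.
Proof.
have [|a x y Bx By|U UP] := vspace_of_pred (P := bounded_orbit).
- by exists 0 => w; rewrite mulmx0 normr0.
- exact: bounded_orbit_lin.
have /choice[C HC] i : exists C, forall w,
    `|word_mx A w *m projv U (delta_mx i 0)| <= C.
  by have [] := UP (projv U (delta_mx i 0)); rewrite memv_proj => /(_ isT).
have C0 i : 0 <= C i by apply: le_trans (HC i [::]).
exists (\sum_i C i); split=> [|x w Bx]; first exact: sumr_ge0.
have xE : x = \sum_i x i 0 *: projv U (delta_mx i 0).
  rewrite -[LHS](@projv_id _ _ U) ?UP// {1}[x]matrix_sum_delta linear_sum.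
  by apply: eq_bigr => i _; rewrite big_ord1 linearZ.
rewrite {1}xE mulmx_sumr (le_trans (ler_norm_sum _ _ _)) // mulr_suml.
apply: ler_sum => i _; rewrite -scalemxAr normrZ mulrC.
by rewrite ler_pM // mx_norm_entry.
Qed.

(** From a vector with unbounded orbit one can go arbitrarily far without
entering the subspace of bounded orbits.  Otherwise all orbit points outside
that subspace have norm at most C; a word leading into the subspace enters it
by one letter from such a point, hence at a bounded vector, and afterwards the
uniform bound on the subspace applies.  The whole orbit would be bounded. *)
Lemma unbounded_orbit_extend x (C : R) : ~ bounded_orbit x ->
  exists v, ~ bounded_orbit (word_mx A v *m x) /\ C < `|word_mx A v *m x|.
Proof.
move=> nBx; apply: contrapT => noext; apply: (nBx).
have small v : ~ bounded_orbit (word_mx A v *m x) -> `|word_mx A v *m x| <= C.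
  by move=> nBv; rewrite leNgt; apply/negP => Cv; apply: noext; exists v.
have [D [D0 BD]] := bounded_orbit_uniform.
pose a := \sum_j n%:R * `|A j|.
have aA j (y : 'cV[R]_n) : `|A j *m y| <= a * `|y|.
  rewrite (le_trans (mx_norm_mulmx _ _)) // mulrA ler_wpM2r //.
  by rewrite /a (bigD1 j) //= lerDl sumr_ge0 // => i _; rewrite mulr_ge0.
have a0 : 0 <= a by apply: sumr_ge0 => j _; rewrite mulr_ge0.
(* The word u is the part of w that ends on the first entry into the subspace. *)
have split_word w : ~ bounded_orbit (word_mx A w *m x) \/
    exists u v, [/\ w = u ++ v, bounded_orbit (word_mx A u *m x) &
                    `|word_mx A u *m x| <= a * C].
  elim/last_ind: w => [|w j [nBw|[u [v [-> Bu uC]]]]].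
  - by left; rewrite mul1mx.
  - have [Bwj|] := pselect (bounded_orbit (word_mx A (rcons w j) *m x)).
      right; exists (rcons w j), [::]; rewrite cats0; split=> //.
      rewrite -cats1 word_mx_cat word_mx1 -mulmxA.
      by apply: le_trans (aA _ _) _; rewrite ler_wpM2l // small.
    by left.
  - by right; exists u, (rcons v j); rewrite -rcons_cat.
exists (Num.max C (D * (a * C))) => w.
rewrite le_max; apply/orP; case: (split_word w) => [/small|]; first by left.
move=> [u [v [-> Bu uC]]]; right; rewrite word_mx_cat -mulmxA.
by rewrite (le_trans (BD _ _ Bu)) // ler_wpM2l.
Qed.

(** Iterating [unbounded_orbit_extend] with thresholds tending to infinity
yields one infinite word along which the products are unbounded, so they
cannot converge. *)
Lemma LCP_bounded_orbit : LCP A -> forall x, bounded_orbit x.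
Proof.
move=> lcp x; apply: contrapT => nBx.
(* Requiring the norm to exceed that of the previous vector as well makes every
   extension nonempty. *)
have ext (uq : seq 'I_k * nat) : exists v, ~ bounded_orbit (word_mx A uq.1 *m x) ->
    ~ bounded_orbit (word_mx A (uq.1 ++ v) *m x) /\
    uq.2%:R + `|word_mx A uq.1 *m x| < `|word_mx A (uq.1 ++ v) *m x|.
  have [Bu|nBu] := pselect (bounded_orbit (word_mx A uq.1 *m x)).
    by exists [::] => /(_ Bu).
  have [v Hv] := unbounded_orbit_extend (uq.2%:R + `|word_mx A uq.1 *m x|) nBu.
  by exists v => _; rewrite word_mx_cat -mulmxA.
have [f Hf] := choice ext.
pose u := fix u q := if q is q'.+1 then u q' ++ f (u q', q') else [::].
have nBu q : ~ bounded_orbit (word_mx A (u q) *m x).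
  by elim: q => [|q IH] /=; [rewrite mul1mx | exact: (Hf (u q, q) IH).1].
have grow q : q%:R + `|word_mx A (u q) *m x| < `|word_mx A (u q.+1) *m x|.
  exact: (Hf (u q, q) (nBu q)).2.
have [||t tu] := @infinite_word _ u.
- by move=> q; exact: prefix_prefix.
- move=> q /=; rewrite size_cat -[X in (X < _)%N]addn0 ltn_add2l lt0n size_eq0.
  apply/eqP => fu; have := grow q; rewrite /= fu cats0.
  by rewrite gtrDr ltNge ler0n.
have [L tL] := lcp t.
have := cvg_seq_bounded (cvgP _ tL).
move=> [M [_ /(_ (M + 1))]]; rewrite ltrDl ltr01 => /(_ isT) HM.
have := grow (Num.bound (n%:R * ((M + 1) * `|x|))).
set q := Num.bound _; rewrite -[u q.+1]tu -left_product_word.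
apply/negP; rewrite -leNgt (le_trans (mx_norm_mulmx _ _)) //.
rewrite (@le_trans _ _ (n%:R * ((M + 1) * `|x|))) //.
  by rewrite ler_wpM2l // ler_wpM2r //; exact: (HM _ I).
rewrite (@le_trans _ _ q%:R) ?lerDl // ltW //.
apply: archi_boundP.
by rewrite mulr_ge0 // mulr_ge0 // (le_trans _ (HM 0 I)).
Qed.

Lemma LCP_bounded : LCP A -> exists C, forall w, `|word_mx A w| <= C.
Proof.
move=> lcp; have /choice[C HC] (j : 'I_n) := LCP_bounded_orbit lcp (delta_mx j 0).
have C0 j : 0 <= C j by apply: le_trans (HC j [::]).
exists (\sum_j C j) => w; apply: mx_norm_le => [|i j]; first exact: sumr_ge0.
rewrite (@le_trans _ _ (C j)) //.
  have -> : word_mx A w i j = (word_mx A w *m (delta_mx j 0 : 'cV_n)) i 0.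
    by rewrite -colE mxE.
  exact: le_trans (mx_norm_entry _ _ _) (HC _ _).
by rewrite (bigD1 j) //= lerDl sumr_ge0.
Qed.

End Boundedness.

(** * Limits of products and the two subspaces *)

Section Subspaces.
Context (R : realType) (n k : nat) (A : 'I_k -> 'M[R]_n).
Implicit Types (J : {set 'I_k}) (s : nat -> 'I_k).

Lemma memv_common_null J x :
  x \in common_null A J <-> forall j, j \in J -> A j *m x = x.
Proof.
rewrite /common_null memvE; split=> [/subv_bigcapP xN j jJ|xJ].
  have := xN j jJ; rewrite -memvE => /memv_nullspace.
  by rewrite mulmxBl mul1mx => /subr0_eq.
apply/subv_bigcapP => j jJ; rewrite -memvE; apply/memv_nullspace.
by rewrite mulmxBl mul1mx xJ // subrr.
Qed.

Lemma memv_range_span_step J j x : j \in J -> A j *m x - x \in range_span A J.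
Proof.
move=> jJ; apply: subvP (sumv_sup j jJ (subvv _)) _ _.
by apply/memv_range_space; exists (- x); rewrite mulmxN mulmxBl mul1mx opprB.
Qed.

Lemma range_span_annihilated p J (G : 'M[R]_(p, n)) x :
  (forall j, j \in J -> G *m A j = G) -> x \in range_span A J -> G *m x = 0.
Proof.
move=> GA /memv_sumP[y yR ->]; rewrite mulmx_sumr big1 // => j jJ.
have /memv_range_space[z ->] := yR j jJ.
by rewrite mulmxA mulmxBr mulmx1 GA // subrr mul0mx.
Qed.

Lemma word_mx_null J w x : {subset w <= J} -> x \in common_null A J ->
  word_mx A w *m x = x.
Proof.
move=> + /memv_common_null xN; elim: w => [|j w IH] wJ /=; first by rewrite mul1mx.
rewrite -mulmxA xN ?wJ ?mem_head // IH // => i iw.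
by rewrite wJ // inE iw orbT.
Qed.

Lemma word_mx_range J w x : {subset w <= J} ->
  word_mx A w *m x - x \in range_span A J.
Proof.
elim: w x => [|j w IH] x wJ /=; first by rewrite mul1mx subrr mem0v.
rewrite -mulmxA -[X in X - _](subrK (A j *m x)) -addrA rpredD //.
  by apply: IH => i iw; rewrite wJ // inE iw orbT.
by apply: memv_range_span_step; rewrite wJ ?mem_head.
Qed.

Definition exhausts J s :=
  (forall m, s m \in J) /\
  (forall j, j \in J -> forall m, exists2 p, (m <= p)%N & s p = j).

Lemma mkseq_sub J s m : (forall m, s m \in J) -> {subset mkseq s m <= J}.
Proof. by move=> sJ _ /mapP[i _ ->]. Qed.

Section LeftLimit.
Context (J : {set 'I_k}) (s : nat -> 'I_k) (L : 'M[R]_n).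
Hypotheses (sJ : exhausts J s) (sL : left_product A s @ \oo --> L).

Lemma left_limit_fixed j : j \in J -> A j *m L = L.
Proof.
move=> jJ; apply/eqP; rewrite -subr_eq0; apply/eqP.
apply: (@cvg_frequently0 _ _
  (fun m => A j *m left_product A s m - left_product A s m.+1)).
  by apply: cvgB; [exact: cvg_mulmxl | rewrite cvg_shiftS].
by move=> m; have [p mp <-] := sJ.2 j jJ m; exists p; rewrite //= subrr.
Qed.

Lemma left_limit_range x : L *m x - x \in range_span A J.
Proof.
have [G GP] := vspace_mulmx_kernel (range_span A J); apply/GP.
apply: (@cvg_frequently0 _ _
    (fun m => G *m (left_product A s m *m x - x))) => [|m].
  by apply: cvg_mulmxl; apply: cvgB; [exact: cvg_mulmxr | exact: cvg_cst].
exists m => //; apply/GP; rewrite left_product_word.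
exact: word_mx_range (mkseq_sub sJ.1).
Qed.

Lemma left_limit_in_null x : L *m x \in common_null A J.
Proof. by apply/memv_common_null => j jJ; rewrite mulmxA left_limit_fixed. Qed.

Lemma left_limit_add : (common_null A J + range_span A J)%VS = fullv.
Proof.
apply/eqP; rewrite eqEsubv subvf; apply/subvP => x _.
rewrite -[x](subrK (L *m x)) addrC memv_add // ?left_limit_in_null //.
by rewrite -opprB rpredN left_limit_range.
Qed.

End LeftLimit.

(** Both limits send x into N, and both differ from x by an element of R; so
their difference lies in the intersection. *)
Lemma left_limit_unique J s t (L M : 'M[R]_n) :
  (common_null A J :&: range_span A J = 0)%VS ->
  exhausts J s -> exhausts J t ->
  left_product A s @ \oo --> L -> left_product A t @ \oo --> M -> L = M.
Proof.
move=> NR0 sJ tJ sL tM; apply: mulmx_cV_inj => x.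
apply/eqP; rewrite -subr_eq0 -memv0 -NR0 memv_cap rpredB //=.
- rewrite -[L *m x](subrK x) -addrA -[x - _]opprB rpredB //.
    exact: left_limit_range sL x.
  exact: left_limit_range tM x.
- exact: left_limit_in_null sL x.
- exact: left_limit_in_null tM x.
Qed.

Section RightLimit.
Context (J : {set 'I_k}) (s : nat -> 'I_k) (L : 'M[R]_n).
Hypotheses (sJ : exhausts J s) (sL : right_product A s @ \oo --> L).

Lemma right_limit_fixed j : j \in J -> L *m A j = L.
Proof.
move=> jJ; apply/eqP; rewrite -subr_eq0; apply/eqP.
apply: (@cvg_frequently0 _ _
  (fun m => right_product A s m *m A j - right_product A s m.+1)).
  by apply: cvgB; [exact: cvg_mulmxr | rewrite cvg_shiftS].
by move=> m; have [p mp <-] := sJ.2 j jJ m; exists p; rewrite //= subrr.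
Qed.

Lemma right_limit_null x : x \in common_null A J -> L *m x = x.
Proof.
move=> xN; apply: subr0_eq.
apply: (@cvg_frequently0 _ _ (fun m => right_product A s m *m x - x)) => [|m].
  by apply: cvgB; [exact: cvg_mulmxr | exact: cvg_cst].
exists m => //; rewrite right_productE (@word_mx_null J) ?subrr // => i.
rewrite mem_rev.
by apply: mkseq_sub => l; exact: sJ.1.
Qed.

Lemma right_limit_cap : (common_null A J :&: range_span A J)%VS = 0%VS.
Proof.
apply/eqP; rewrite -subv0; apply/subvP => x; rewrite memv_cap => /andP[xN xR].
rewrite memv0 -(right_limit_null xN).
by rewrite (range_span_annihilated right_limit_fixed xR).
Qed.

End RightLimit.

(** Cycle through an enumeration of J. *)
Lemma exists_exhausts J : J != finset.set0 -> exists s, exhausts J s.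
Proof.
move=> /finset.set0Pn[j0 j0J]; pose e := enum J.
have e0 : (0 < size e)%N by rewrite -cardE; apply/card_gt0P; exists j0.
exists (fun m => nth j0 e (m %% size e)%N); split=> [m|j jJ m].
  by rewrite -mem_enum mem_nth // ltn_pmod.
have je : j \in e by rewrite mem_enum.
exists (m * size e + index j e)%N.
  by apply: leq_trans (leq_addr _ _); rewrite leq_pmulr.
by rewrite modnMDl modn_small ?index_mem // nth_index.
Qed.

Lemma common_null0 : common_null A finset.set0 = fullv.
Proof. by rewrite /common_null finset.big_set0. Qed.

Lemma range_span0 : range_span A finset.set0 = 0%VS.
Proof. by rewrite /range_span finset.big_set0. Qed.

(** The empty set of letters supports no sequence and is treated apart. *)
Lemma LCP_add J : LCP A -> (common_null A J + range_span A J = fullv)%VS.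
Proof.
move=> lcp; have [->|/exists_exhausts[s sJ]] := eqVneq J finset.set0.
  by rewrite common_null0 range_span0 addv0.
by have [L sL] := lcp s; exact: left_limit_add sJ sL.
Qed.

Lemma RCP_cap J : RCP A -> (common_null A J :&: range_span A J = 0)%VS.
Proof.
move=> rcp; have [->|/exists_exhausts[s sJ]] := eqVneq J finset.set0.
  by rewrite range_span0 capv0.
by have [L sL] := rcp s; exact: right_limit_cap sJ sL.
Qed.

End Subspaces.

(** * Convergence of right products from that of left products *)

Section LeftToRight.
Context (R : realType) (n k : nat) (A : 'I_k -> 'M[R]_n).
Implicit Types (J : {set 'I_k}) (s : nat -> 'I_k).

Lemma eventually_exhausts s :
  exists J m0, exhausts J (fun m => s (m0 + m)%N).
Proof.
pose io j := `[< forall m, exists2 p, (m <= p)%N & s p = j >].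
have /choice[b bP] j : exists b, forall p, (b <= p)%N -> s p = j -> io j.
  have [ioj|nioj] := boolP (io j); first by exists 0%N.
  have /asboolPn/existsNP[m mP] := nioj; exists m => p mp spj.
  by exfalso; apply: mP; exists p.
pose m0 := (\max_j b j)%N.
exists (finset.finset io), m0; split=> [m|j].
  rewrite finset.in_set; apply: (bP _ (m0 + m)%N) => //.
  exact: leq_trans (leq_bigmax _) (leq_addr _ _).
rewrite finset.in_set => /asboolP ioj m; have [p mp spj] := ioj (m0 + m)%N.
have m0p : (m0 <= p)%N by apply: leq_trans mp; exact: leq_addr.
by exists (p - m0)%N; rewrite ?subnKC // leq_subRL.
Qed.

Lemma exhausts_block J s m : exhausts J s ->
  exists M, forall p, (M <= p)%N -> {subset J <= mkseq (fun i => s (m + i)%N) p}.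
Proof.
move=> sJ; have /choice[b bP] j : exists b, j \in J -> s (m + b)%N = j.
  have [jJ|njJ] := boolP (j \in J); last by exists 0%N.
  have [p mp spj] := sJ.2 j jJ m; exists (p - m)%N => _.
  by rewrite subnKC.
exists (\max_j b j).+1%N => p bp j jJ; rewrite -(bP j jJ); apply/mapP.
exists (b j) => //; rewrite mem_iota add0n; apply: leq_trans bp.
by rewrite ltnS leq_bigmax.
Qed.

Section Tail.
Context (J : {set 'I_k}) (s : nat -> 'I_k) (L : 'M[R]_n).
Hypotheses (lcp : LCP A) (sJ : exhausts J s)
  (NR0 : (common_null A J :&: range_span A J = 0)%VS)
  (sL : left_product A s @ \oo --> L).

(** Concatenate blocks v_0, v_1, ... with errors d / 2, d / 4, ... into an
infinite word t.  Since t exhausts J, its left products converge to L; since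
the product of v_q nearly fixes y, it can be dropped from the front of the
product of v_q, ..., v_0 applied to y at the cost of a constant times its
error.  So y L is within a multiple of d of y, for every d. *)
Lemma recurrent_row_fixed (y : 'rV[R]_n) :
  (forall e : R, 0 < e -> exists v : seq 'I_k,
     [/\ {subset v <= J}, {subset J <= v} &
     `|y *m word_mx A v - y| <= e]) ->
  y *m L = y.
Proof.
move=> rec; have [C HC] := LCP_bounded lcp.
have C0 : 0 <= C by apply: le_trans (HC [::]).
apply/eqP; rewrite -subr_eq0 -normr_le0; apply/ler_addgt0Pr => e e0.
rewrite add0r.
(* The word is allowed a total error n C d on its prefixes, and d more is spent
   on passing to the limit. *)
pose d := e / (n%:R * C + 1).
have den0 : 0 < n%:R * C + 1 by rewrite ltr_wpDl // mulr_ge0.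
have d0 : 0 < d by rewrite divr_gt0.
have /choice[v vP] (q : nat) :=
  rec (d / 2 ^+ q.+1) (divr_gt0 d0 (exprn_gt0 _ (ltr0Sn R 1))).
pose u := fix u q := if q is q'.+1 then u q' ++ v q' else [::].
have uJ q : {subset u q <= J}.
  elim: q => [//|q IH] i /=; rewrite mem_cat => /orP[/IH//|].
  by have [vJ _ _] := vP q; exact: vJ.
have usz q : (size (u q) < size (u q.+1))%N.
  rewrite /= size_cat -[X in (X < _)%N]addn0 ltn_add2l.
  by have [_ /(_ _ (sJ.1 0)) + _] := vP q; case: (v q).
have [q|//|t tu] := @infinite_word _ u; first exact: prefix_prefix.
have qsz q : (q <= size (u q))%N.
  by elim: q => // q IH; exact: leq_ltn_trans (usz q).
have tJ : exhausts J t.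
  split=> [m|j jJ m].
    apply: (uJ m.+1); rewrite -tu; apply/mapP; exists m => //.
    by rewrite mem_iota; exact: qsz.
  have [_ /(_ _ jJ) jv _] := vP m.
  have im := jv; rewrite -index_mem in im.
  exists (size (u m) + index j (v m))%N.
    exact: leq_trans (qsz m) (leq_addr _ _).
  have lt_m : (size (u m) + index j (v m) < size (u m.+1))%N.
    by rewrite /= size_cat ltn_add2l.
  rewrite -(nth_mkseq j t lt_m) tu /= nth_cat ltnNge leq_addr /= addKn.
  exact: nth_index.
have close q : `|y *m left_product A t (size (u q)) - y| <=
    n%:R * C * d * (1 - 2 ^- q).
  rewrite left_product_word tu; elim: q => [|q IH].
    by rewrite /= mulmx1 expr0 invr1 !subrr normr0 mulr0.
  have [_ _ vq] := vP q.
  have -> : y *m word_mx A (u q.+1) - y =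
      (y *m word_mx A (v q) - y) *m word_mx A (u q) + (y *m word_mx A (u q) - y).
    by rewrite /= word_mx_cat mulmxBl mulmxA addrA subrK.
  rewrite (le_trans (ler_normD _ _)) //.
  rewrite (le_trans (lerD (mx_norm_mulmx _ _) IH)) //.
  have -> : n%:R * C * d * (1 - 2 ^- q.+1) =
      n%:R * (d / 2 ^+ q.+1 * C) + n%:R * C * d * (1 - 2 ^- q).
    by rewrite exprS invfM; field.
  by rewrite lerD2r ler_wpM2l // ler_pM.
have [M tM] := lcp t.
rewrite (left_limit_unique NR0 sJ tJ sL tM).
have : (fun m => y *m left_product A t m - y) @ \oo --> y *m M - y.
  by apply: cvgB; [exact: cvg_mulmxl | exact: cvg_cst].
move=> /cvgrPdist_le /(_ d d0)[q _ Hq].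
have := Hq (size (u q)) (qsz q); set z := y *m left_product _ _ _ - y => Hz.
rewrite -[y *m M - y](subrK z) (le_trans (ler_normD _ _)) //.
have -> : e = d + n%:R * C * d by rewrite /d; field; rewrite gt_eqF.
rewrite lerD // (le_trans (close q)) // ler_piMr //.
by apply: mulr_ge0 (ltW d0); rewrite mulr_ge0.
Qed.

Lemma word_mx_limit w : {subset w <= J} -> word_mx A w *m L = L.
Proof.
move=> wJ; apply: mulmx_cV_inj => x; rewrite -mulmxA.
by rewrite (word_mx_null wJ) //; exact: left_limit_in_null sJ sL x.
Qed.

(** Two visits of the orbit near y, far enough apart, delimit a block as
required by [recurrent_row_fixed]; this gives y L = y.  And y L = z L because
every point of the orbit is mapped to z L by L. *)
Lemma cluster_right_orbit (z y : 'rV[R]_n) :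
  cluster ((fun m => z *m right_product A s m) @ \oo) y -> y = z *m L.
Proof.
move=> ycl; have [C HC] := LCP_bounded lcp.
have C0 : 0 <= C by apply: le_trans (HC [::]).
have near_y e m : 0 < e ->
    exists2 p, (m <= p)%N & `|y - z *m right_product A s p| <= e.
  move=> e0.
  have [||_ [[p mp <-] yp]] :=
    ycl [set z *m right_product A s p | p in [set p | (m <= p)%N]] (ball y e).
  - by exists m => //= p mp; exists p.
  - exact: nbhsx_ballx.
  by exists p => //; move: yp; rewrite -ball_normE => /ltW.
have yL : y *m L = z *m L.
  apply/eqP; rewrite -subr_eq0 -normr_le0; apply/ler_addgt0Pr => e e0.
  rewrite add0r.
  have den0 : 0 < n%:R * `|L| + 1 by rewrite ltr_wpDl // mulr_ge0.
  have [p _ yp] := near_y (e / (n%:R * `|L| + 1)) 0%N (divr_gt0 e0 den0).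
  have -> : z *m L = z *m right_product A s p *m L.
    rewrite -mulmxA right_productE word_mx_limit // => i; rewrite mem_rev.
    exact: mkseq_sub sJ.1 _.
  rewrite -mulmxBl (le_trans (mx_norm_mulmx _ _)) //.
  have -> : e = n%:R * (e / (n%:R * `|L| + 1) * `|L|) + e / (n%:R * `|L| + 1).
    by field; rewrite gt_eqF.
  by rewrite ler_wpDr ?divr_ge0 ?(ltW e0) ?(ltW den0) // ler_wpM2l // ler_wpM2r.
rewrite -yL; apply/esym/recurrent_row_fixed => e e0.
have den0 : 0 < n%:R * C + 1 by rewrite ltr_wpDl // mulr_ge0.
have d0 := divr_gt0 e0 den0; set d := e / _ in d0.
have [m _ ym] := near_y d 0%N d0.
have [M MP] := exhausts_block m sJ.
have [p mMp yp] := near_y d (m + M)%N d0.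
have mp : (m <= p)%N by apply: leq_trans mMp; exact: leq_addr.
exists (rev (mkseq (fun i => s (m + i)%N) (p - m))); split.
- by move=> i; rewrite mem_rev; apply: mkseq_sub => l; exact: sJ.1.
- by move=> j jJ; rewrite mem_rev; apply: MP => //; rewrite leq_subRL.
set W := word_mx A _.
have -> : y *m W - y = (y - z *m right_product A s m) *m W -
    (y - z *m right_product A s p).
  by rewrite -[in RHS](subnKC mp) right_product_word -/W mulmxA mulmxBl
    opprB addrA subrK.
rewrite (le_trans (ler_normB _ _)) //.
have -> : e = n%:R * (d * C) + d by rewrite /d; field; rewrite gt_eqF.
rewrite lerD // (le_trans (mx_norm_mulmx _ _)) // ler_wpM2l // ler_pM //.
exact: HC.
Qed.

(** A bounded orbit in a finite-dimensional space with at most one cluster point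
converges to it.  The radius B leaves room for a unit ball around z L. *)
Lemma right_orbit_cvg (z : 'rV[R]_n) :
  (fun m => z *m right_product A s m) @ \oo --> z *m L.
Proof.
have [C HC] := LCP_bounded lcp.
have C0 : 0 <= C by apply: le_trans (HC [::]).
pose B := n%:R * (`|z| * C) + `|z *m L| + 1.
pose V := [set y : 'rV[R]_n | `|y| <= B].
have cV : compact V.
  apply: bounded_closed_compact.
    exists B; split; first exact: num_real.
    by move=> D BD y /le_trans; apply; exact: ltW.
  apply: (@preimage_closed _ _ (fun y : 'rV[R]_n => `|y|) [set r | r <= B]).
    by move=> y _; exact: norm_continuous.
  exact: closed_le.
have orbV m : V (z *m right_product A s m).
  rewrite /V /= right_productE (le_trans (mx_norm_mulmx _ _)) //.
  rewrite /B -addrA ler_wpDr ?addr_ge0 // ler_wpM2l // ler_wpM2l //.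
have FV : ((fun m => z *m right_product A s m) @ \oo) V.
  by exists 0%N => // m _; exact: orbV.
apply: (compact_cluster_set1 _ cV) => //.
- apply/nbhs_ballP; exists 1 => //= y; rewrite -ball_normE /= distrC => yz.
  rewrite /V /= -[y](subrK (z *m L)) (le_trans (ler_normD _ _)) // addrC.
  rewrite /B -addrA ler_wpDl ?mulr_ge0 // lerD2l.
  exact: ltW.
- apply/seteqP; split=> [y|_ ->]; first exact: cluster_right_orbit.
  have [y [_ ycl]] := cV _ _ FV.
  by rewrite -(cluster_right_orbit ycl).
Qed.

End Tail.

(** Applied to each row of the product over the discarded prefix, the
convergence of row orbits gives that of the matrices. *)
Lemma LCP_RCP : LCP A ->
  (forall J, (common_null A J :&: range_span A J = 0)%VS) -> RCP A.
Proof.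
move=> lcp cap0 s; have [J [m0 tJ]] := eventually_exhausts s.
set t := (fun m => _) in tJ; have [L tL] := lcp t.
exists (right_product A s m0 *m L).
rewrite -(cvg_shiftn m0); apply/mx_cvgP => i j.
have /mx_cvgP/(_ 0 j) := right_orbit_cvg lcp tJ (cap0 J) tL
  (z := row i (right_product A s m0)).
rewrite -row_mul mxE; under eq_cvg do rewrite -row_mul mxE.
apply: cvg_trans; apply: near_eq_cvg; near=> m.
by rewrite /= addnC right_product_word -right_productE.
Unshelve. all: by end_near. Qed.

End LeftToRight.

(** * Transposition and the equivalences *)

Lemma left_product_tr (R : realType) (n k : nat) (A : 'I_k -> 'M[R]_n) s m :
  left_product (fun j => (A j)^T) s m = (right_product A s m)^T.
Proof. by elim: m => [|m IH] /=; rewrite ?trmx1 // IH trmx_mul. Qed.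

Lemma right_product_tr (R : realType) (n k : nat) (A : 'I_k -> 'M[R]_n) s m :
  right_product (fun j => (A j)^T) s m = (left_product A s m)^T.
Proof. by elim: m => [|m IH] /=; rewrite ?trmx1 // IH trmx_mul. Qed.

Lemma LCP_tr (R : realType) (n k : nat) (A : 'I_k -> 'M[R]_n) :
  RCP A -> LCP (fun j => (A j)^T).
Proof.
move=> rcp s; have [L sL] := rcp s; exists L^T.
by under eq_cvg do rewrite left_product_tr; exact: cvg_trmx.
Qed.

Lemma RCP_tr (R : realType) (n k : nat) (A : 'I_k -> 'M[R]_n) :
  RCP (fun j => (A j)^T) -> LCP A.
Proof.
move=> rcp s; have [L sL] := rcp s; exists L^T.
under eq_cvg do rewrite -[left_product A s _]trmxK -right_product_tr.
exact: cvg_trmx.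
Qed.

(** If x lies in both subspaces of the transposed family, then the row x^T is
fixed by every A_j, hence kills R; and it kills each a in N because a^T is
fixed by every transposed matrix and so kills x.  Thus x^T kills N + R, the
whole space. *)
Lemma cap_tr (R : realType) (n k : nat) (A : 'I_k -> 'M[R]_n) (J : {set 'I_k}) :
  (common_null A J + range_span A J)%VS = fullv ->
  (common_null (fun j => (A j)^T) J :&: range_span (fun j => (A j)^T) J)%VS = 0%VS.
Proof.
move=> NR; apply/eqP; rewrite -subv0; apply/subvP => x.
rewrite memv_cap => /andP[/memv_common_null xN xR].
have xNR (z : 'cV_n) : x^T *m z = 0.
  have : z \in (common_null A J + range_span A J)%VS by rewrite NR memvf.
  move=> /memv_addP[a /memv_common_null aN [b bR ->]]; rewrite mulmxDr.
  have -> : x^T *m a = 0.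
    rewrite -[LHS]trmxK trmx_mul trmxK.
    rewrite (range_span_annihilated _ xR) ?trmx0 // => j jJ.
    by rewrite -trmx_mul aN.
  rewrite (range_span_annihilated _ bR) ?addr0 // => j jJ.
  by rewrite -[x in RHS](xN j jJ) trmx_mul trmxK.
rewrite memv0 -[x]trmxK; apply/eqP/trmx_inj; rewrite trmxK trmx0.
by apply: mulmx_cV_inj => z; rewrite mul0mx xNR.
Qed.

Theorem theorem3p4 (R : realType) (n k : nat) (A : 'I_k -> 'M[R]_n) :
  (LCP A -> RCP A -> transversal_family A) /\
  (LCP A -> transversal_family A -> RCP A) /\
  (RCP A -> transversal_family A -> LCP A).
Proof.
split; [|split].
- by move=> lcp rcp J; split; [exact: RCP_cap | exact: LCP_add].
- by move=> lcp tr; apply: LCP_RCP => // J; exact: (tr J).1.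
- move=> rcp tr; apply/RCP_tr/LCP_RCP => [|J]; first exact: LCP_tr.
  exact: cap_tr (tr J).2.
Qed.
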